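(* Let $k>2$ be an integer, $n=2k$, $q$ an odd prime power and $\eta$ a non-square element of $\mathbb{F}_{q^n}$. Let $s,t$ be integers with $\gcd(s,n)=\gcd(t,n)=1$. Define \[ \mathcal{S}_{n,n-2,s}=\Big\{(x,y)\mapsto\mathrm{Tr}\big(c_0xy+c_1(x^{q^{s}}y+y^{q^{s}}x)\big): c_0,c_1\in\mathbb{F}_{q^n}\Big\} \] and \[ \mathcal{T}_{n,t,\eta}=\Big\{(x,y)\mapsto \mathrm{Tr}\Big(b_0x^{q^{k}}y+b_1\big(x^{q^{t(k-1)}}y+y^{q^{t(k-1)}}x\big)+\eta b_2\big(x^{q^{t(k-2)}}y+y^{q^{t(k-2)}}x\big)\Big) : b_0,b_2\in\mathbb{F}_{q^k},\ b_1\in\mathbb{F}_{q^{2k}}\Big\}. \] Then $\mathcal{S}_{n,n-2,s}$ and $\mathcal{T}_{n,t,\eta}$ are not equivalent in $\mathscr{S}_n(q)$.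
   Context: $\mathrm{Tr}$ is the absolute trace from $\mathbb{F}_{q^n}$ to $\mathbb{F}_q$; both sets consist of symmetric $\mathbb{F}_q$-bilinear forms on $\mathbb{F}_{q^n}$, identified with symmetric $n\times n$ matrices over $\mathbb{F}_q$ via a fixed $\mathbb{F}_q$-basis; $\mathscr{S}_n(q)$ is the set of symmetric $n\times n$ matrices over $\mathbb{F}_q$. Two subsets $\mathcal{C}_1,\mathcal{C}_2\subseteq\mathscr{S}_n(q)$ are equivalent if there exist $a\in\mathbb{F}_q^*$, an invertible $P\in\mathbb{F}_q^{n\times n}$, a field automorphism $\sigma$ of $\mathbb{F}_q$ and $S_0\in\mathscr{S}_n(q)$ such that $\mathcal{C}_2=\{aP^{T}C^{\sigma}P+S_0: C\in\mathcal{C}_1\}$, where $C^\sigma$ denotes applying $\sigma$ entrywise. *)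

(* Defs.v *)
From mathcomp Require Import all_boot all_order all_fingroup all_algebra.
From mathcomp Require Import all_solvable all_field.

Set Implicit Arguments.
Unset Strict Implicit.
Unset Printing Implicit Defensive.

Import GRing.Theory.
Local Open Scope ring_scope.

Section FieldMaps.

Variables (F : finFieldType) (L : splittingFieldType F).
Implicit Types (x y : L) (i j : int).

(* The field trace L -> F: galTrace takes its values in the line F . 1 of L,
   and coord reads off the scalar (see traceE). *)
Definition trace x : F := coord [tuple 1] ord0 (galTrace 1 {:L} x).

(* x^(q^i) with q = #|F| and i : int. As x^(q^n) = x for n = [L : F], the
   exponent i only matters modulo n; a negative i denotes a power of the
   inverse of the Frobenius (see frobE and frobD). *)
Definition frob i x : L := x ^+ (#|F| ^ `|(i %% (\dim {:L})%:Z)%Z|)%N.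

Lemma traceE x : (trace x)%:A = galTrace 1 {:L} x.
Proof.
have gal1 : galois 1 {:L} by apply: finField_galois; apply: sub1v.
have /vlineP[a Da] : galTrace 1 {:L} x \in 1%VS by apply/mem_galTrace/memvf.
rewrite /trace Da linearZ /=.
by rewrite (coord_free ord0 ord0) ?mulr1 // seq1_free oner_neq0.
Qed.

Lemma Frobenius_gal : {alpha : gal_of {:L} | alpha \in 'Gal({:L} / 1)%g
  & forall m x, (alpha ^+ m)%g x = x ^+ (#|F| ^ m)}.
Proof.
have [alpha gen Da] := finField_galois_generator (sub1v {:L}%AS).
exists alpha => [|m x]; first by rewrite (eqP gen) cycle_id.
elim: m => [|m IHm]; first by rewrite gal_id.
by rewrite expgSr galM ?memvf // IHm Da ?memvf // dimv1 expn1 expnSr exprM.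
Qed.

Lemma expf_dim x : x ^+ (#|F| ^ \dim {:L}) = x.
Proof. by apply/eqP; rewrite -Fermat's_little_theorem memvf. Qed.

Lemma frobE (m : nat) x : frob m x = x ^+ (#|F| ^ m).
Proof.
rewrite /frob modz_nat absz_nat [in RHS](divn_eq m (\dim {:L})).
rewrite addnC expnD exprM; elim: (_ %/ _)%N => [|d IHd]; first by rewrite expr1.
by rewrite mulSn expnD mulnC exprM -IHd expf_dim.
Qed.

Lemma frobD i j x : frob (i + j) x = frob i (frob j x).
Proof.
have n0 : ((\dim {:L})%:Z != 0)%R by rewrite eqz_nat -lt0n adim_gt0.
have modE l : ((l %% (\dim {:L})%:Z)%Z = `|(l %% (\dim {:L})%:Z)%Z|%N :> int)%R.
  by rewrite gez0_abs ?modz_ge0.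
have -> : frob (i + j) x
    = frob (`|(i %% (\dim {:L})%:Z)%Z| + `|(j %% (\dim {:L})%:Z)%Z|)%N x.
  by rewrite /frob PoszD -!modE modzDm.
by rewrite frobE /frob -exprM -expnD addnC.
Qed.

Lemma trace_frob i x : trace (frob i x) = trace x.
Proof.
have [alpha galLa Da] := Frobenius_gal.
by rewrite /trace /frob -Da galTrace_gal ?memvf ?groupX.
Qed.

End FieldMaps.

Section Codes.

Variables (F : finFieldType) (L : splittingFieldType F) (n : nat).

Definition form_mx (e : n.-tuple L) (B : L -> L -> F) : 'M[F]_n :=
  \matrix_(i, j) B (tnth e i) (tnth e j).

Definition S_form (s : int) (c0 c1 : L) (x y : L) : F :=
  trace (c0 * x * y + c1 * (frob s x * y + frob s y * x)).

Definition T_form (k : nat) (t : int) (eta b0 b1 b2 : L) (x y : L) : F :=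
  trace (b0 * frob k%:Z x * y
    + b1 * (frob (t * (k%:Z - 1)) x * y + frob (t * (k%:Z - 1)) y * x)
    + eta * b2
        * (frob (t * (k%:Z - 2)) x * y + frob (t * (k%:Z - 2)) y * x)).

Definition S_code (e : n.-tuple L) (s : int) (M : 'M[F]_n) : Prop :=
  exists c0 c1 : L, M = form_mx e (S_form s c0 c1).

(* K plays the role of the subfield F_{q^k} of L = F_{q^(2k)}. *)
Definition T_code (e : n.-tuple L) (k : nat) (K : {subfield L}) (t : int)
    (eta : L) (M : 'M[F]_n) : Prop :=
  exists b0 b1 b2 : L,
    [/\ b0 \in K, b2 \in K & M = form_mx e (T_form k t eta b0 b1 b2)].

Definition is_sym (M : 'M[F]_n) : Prop := M^T = M.

Definition sym_equiv (C1 C2 : 'M[F]_n -> Prop) : Prop :=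
  exists (a : F) (P : 'M[F]_n) (sigma : {rmorphism F -> F}) (S0 : 'M[F]_n),
    [/\ a != 0, P \in unitmx, bijective sigma, is_sym S0
      & forall M, C2 M <->
          exists2 C, C1 C & M = a *: (P^T *m map_mx sigma C *m P) + S0].

Lemma S_code_sym e s M : S_code e s M -> is_sym M.
Proof.
case=> c0 [c1 ->]; apply/matrixP=> i j; rewrite !mxE /S_form.
by rewrite mulrAC [frob _ _ * _ + _]addrC.
Qed.

Lemma T_code_sym e k (K : {subfield L}) t eta M :
  \dim {:L} = (2 * k)%N -> \dim K = k -> T_code e k K t eta M -> is_sym M.
Proof.
move=> dimL dimK [b0 [b1 [b2 [Kb0 _ ->]]]].
have b0k : frob k b0 = b0.
  by apply/eqP; rewrite frobE -dimK -Fermat's_little_theorem.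
have frobM i : {morph @frob F L i : x y / x * y}.
  by move=> x y; rewrite /frob exprMn.
have frobkk (x : L) : frob k (frob k x) = x.
  by rewrite -frobD -PoszD addnn -mul2n -dimL frobE expf_dim.
have trD : {morph @trace F L : x y / x + y}.
  by move=> x y; rewrite /trace !raddfD.
apply/matrixP=> i j; rewrite !mxE /T_form.
rewrite [frob (t * (k%:Z - 1)) (tnth e j) * _ + _]addrC.
rewrite [frob (t * (k%:Z - 2)) (tnth e j) * _ + _]addrC.
rewrite -!addrA trD [RHS]trD; congr (_ + _).
by rewrite -(trace_frob k) !frobM b0k frobkk mulrAC.
Qed.

End Codes.

(* Main.v *)
From HB Require Import structures.
Require Import Defs.
From mathcomp Require Import all_boot all_order all_fingroup all_algebra.
From mathcomp Require Import all_solvable all_field ring zify.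

Set Implicit Arguments.
Unset Strict Implicit.
Unset Printing Implicit Defensive.

Import Order.TTheory GRing.Theory.
Local Open Scope ring_scope.

(* For an [F]-bilinear form written as [Tr(f(x) y)] with [f] a linearized polynomial,
   no element of the second code has a degree-0 term, because [k], [t(k-1)] and
   [t(k-2)] are nonzero modulo [2k]. The first code contains all [Tr(c x y)], and an
   equivalence turns such a form into [Tr(c' g(x) g(y))] with [g] invertible, whose
   degree-0 coefficient is a sum of terms [frob_(-i) (g_i ^+ 2 * c')]. If it vanished
   for all [c'], independence of the Frobenius powers would give [g = 0].
   In matrix terms, with [V] the Moore matrix of the basis and [U] its inverse, the
   degree-0 coefficient and its conjugates are the diagonal of [U *m M *m U^T]. *)

(** * Automorphisms of a finite field and their extension *)

(** Over the prime field, [sigma] is linear, hence an element of the Galois group, which is cyclic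
    and generated by the [p]-th power map. *)
Lemma finField_rmorphismE (F : finFieldType) (sigma : {rmorphism F -> F}) :
  exists p m, p \in [pchar F] /\ forall x, sigma x = x ^+ (p ^ m).
Proof.
have [p p_pr charFp] := finPcharP F.
pose R := pPrimeCharType charFp; pose f : R -> R := sigma.
have f_lin : linear f.
  move=> a x y; rewrite /f (rmorphD sigma); congr (_ + _).
  (* Scalars of the prime field act through natural multiples of 1, which [sigma] fixes. *)
  by rewrite (rmorphM sigma) rmorph_nat.
pose fL := GRing.isLinear.Build _ _ _ _ f f_lin.
pose g : {linear R -> R} := HB.pack f fL.
have gE x : linfun g x = sigma x by rewrite lfunE.
have /kAut_to_gal[beta galb Db] : kAut 1 {:R} (linfun g).
  rewrite kAutE subvf andbT; apply/kHom_monoid_morphism.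
  by split=> [|x y]; rewrite !gE ?rmorph1 ?rmorphM.
have [alpha gen Da] := finField_galois_generator (sub1v {:R}%AS).
move: galb; rewrite (eqP gen) => /cycleP[m Dm]; exists p, m; split=> // x.
rewrite -(gE x) Db ?memvf // {}Dm; elim: m => [|m IHm]; first by rewrite gal_id.
rewrite expgSr galM ?memvf // IHm Da ?memvf // dimv1 expn1 card_Fp //.
by rewrite -exprM -expnSr.
Qed.

(** The power map that computes [sigma] makes sense on [L] too. The extension lets [sigma] act on
    the expansion of a trace into Frobenius conjugates. *)
Lemma finField_rmorphism_extend (F : finFieldType) (L : fieldExtType F)
    (sigma : {rmorphism F -> F}) :
  exists phi : {rmorphism L -> L}, forall c : F, phi c%:A = (sigma c)%:A.
Proof.
have [p [m [charFp sigmaE]]] := finField_rmorphismE sigma.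
have charLp : p \in [pchar L] by rewrite pchar_lalg.
suffices [phi phiE] : exists phi : {rmorphism L -> L},
    forall x, phi x = x ^+ (p ^ m).
  by exists phi => c; rewrite phiE exprZn expr1n sigmaE.
elim: m {sigmaE} => [|m [phi phiE]]; first by exists idfun => x; rewrite expr1.
exists (pFrobenius_aut charLp \o phi) => x.
by rewrite /= phiE pFrobenius_autE -exprM -expnSr.
Qed.

(** * The Moore matrix and its inverse *)

Section Moore.

Variables (F : finFieldType) (L : splittingFieldType F).

Lemma frob_mod (i : int) (x : L) :
  frob (i %% (\dim {:L})%:Z)%Z x = frob i x.
Proof. by rewrite /frob modz_mod. Qed.

Lemma frob_generator : {alpha : gal_of {:L} |
  generator 'Gal({:L} / 1)%g alpha
  & forall m x, frob m%:Z x = (alpha ^+ m)%g x}.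
Proof.
have [alpha gen Da] := finField_galois_generator (sub1v {:L}%AS).
exists alpha => // m x; rewrite frobE.
elim: m => [|m IHm]; first by rewrite gal_id.
by rewrite expgSr galM ?memvf // -IHm Da ?memvf // dimv1 expn1 expnSr exprM.
Qed.

Lemma generator_order (alpha : gal_of {:L}) :
  generator 'Gal({:L} / 1)%g alpha -> #[alpha]%g = \dim {:L}.
Proof.
have gal1 : galois 1 {:L} by apply: finField_galois; apply: sub1v.
by move=> gen; rewrite orderE -(eqP gen) -(galois_dim gal1) dimv1 divn1.
Qed.

Lemma sum_generator (R : nmodType) (alpha : gal_of {:L})
    (h : gal_of {:L} -> R) : generator 'Gal({:L} / 1)%g alpha ->
  \sum_(g in 'Gal({:L} / 1)%g) h g = \sum_(l < \dim {:L}) h (alpha ^+ l)%g.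
Proof.
move=> gen; have oa := generator_order gen.
rewrite (eqP gen).
have -> : \sum_(g in <[alpha]>%g) h g =
    \sum_(g in [set (alpha ^+ l)%g | l : 'I_(\dim {:L})]) h g.
  apply: eq_bigl => g; apply/idP/imsetP => [/cyclePmin[m]|[l _ ->]].
    by rewrite oa => ltm ->; exists (Ordinal ltm).
  exact: mem_cycle.
rewrite big_imset // => i j _ _ /eqP.
rewrite eq_expg_mod_order oa !modn_small // => /eqP ?; exact: val_inj.
Qed.

Lemma trace_sum_frob (x : L) :
  (trace x)%:A = \sum_(l < \dim {:L}) frob l%:Z x.
Proof.
have [alpha gen frobE] := frob_generator.
rewrite traceE /galTrace (sum_generator _ gen).
by apply: eq_bigr => l _; rewrite frobE.
Qed.

Lemma frobM (i : int) : {morph @frob F L i : x y / x * y}.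
Proof. by move=> x y; rewrite /frob exprMn. Qed.

Lemma traceD : {morph @trace F L : x y / x + y}.
Proof. by move=> x y; rewrite /trace !raddfD. Qed.

Lemma trace0 : @trace F L 0 = 0.
Proof. by rewrite /trace !raddf0. Qed.

Variables (n : nat) (e : n.-tuple L).
Hypotheses (dimL : \dim {:L} = n) (basis_e : basis_of {:L} e).

Definition moore_mx : 'M[L]_n := \matrix_(i, l) frob l%:Z (tnth e i).

(** A linear relation between the columns is a relation between the Galois automorphisms on a basis,
    hence on all of [L]; Dedekind independence makes it trivial. *)
Lemma moore_mx_unit : moore_mx \in unitmx.
Proof.
rewrite -unitmx_tr -row_free_unit -kermx_eq0; apply/rowV0P => v /sub_kermxP v0.
have [alpha gen frobE] := frob_generator.
have oa := generator_order gen; rewrite dimL in oa.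
(* This reindexes [v] by group elements: the sum has at most one term, as the powers of [alpha]
   below its order are distinct. *)
pose c g := \sum_(l < n | (alpha ^+ l)%g == g) v ord0 l.
have cE (l : 'I_n) : c (alpha ^+ l)%g = v ord0 l.
  rewrite /c (big_pred1 l) // => i /=.
  by rewrite eq_expg_mod_order oa !modn_small.
apply/rowP => l; rewrite mxE -cE.
apply: (@gal_independent _ _ _ [in 'Gal({:L} / 1)%g]); last first.
  by rewrite /= (eqP gen) mem_cycle.
move=> x _; rewrite (sum_generator _ gen).
have sum0 i : \sum_(l < \dim {:L}) c (alpha ^+ l)%g * (alpha ^+ l)%g e`_i = 0.
  have [ltin|lein] := ltnP i n; last first.
    rewrite nth_default ?size_tuple //.
    by rewrite big1 // => j _; rewrite rmorph0 mulr0.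
  rewrite dimL; have /rowP/(_ (Ordinal ltin)) := v0; rewrite !mxE => v0i.
  rewrite -[RHS]v0i; apply: eq_bigr => j _; rewrite !mxE cE frobE.
  by rewrite (tnth_nth 0).
rewrite (coord_basis basis_e (memvf x)).
under eq_bigr do rewrite linear_sum mulr_sumr.
rewrite exchange_big /= big1 // => i _.
under eq_bigr do rewrite linearZ -scalerAr.
by rewrite -scaler_sumr sum0 scaler0.
Qed.

Let U := invmx moore_mx.

Lemma inv_moore_frob (j : 'I_n) (r : int) :
  \sum_i U j i * frob r (tnth e i) = ((r %% n%:Z)%Z == j%:Z)%:R.
Proof.
have n0 : n%:Z != 0 by rewrite -dimL eqz_nat -lt0n adim_gt0.
have n_gt0 : 0 < n%:Z by rewrite lt_def n0.
have := ltz_pmod r n_gt0; have := modz_ge0 r n0.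
under eq_bigr do rewrite -frob_mod dimL.
case: (r %% n%:Z)%Z => // m _ ltmn.
have /matrixP/(_ j (Ordinal (ltmn : (m < n)%N))) := mulVmx moore_mx_unit.
rewrite !mxE -val_eqE /= eqz_nat eq_sym => <-.
by apply: eq_bigr => i _; rewrite !mxE.
Qed.

(** * Forms without degree-0 term *)

Definition zero_diag (M : 'M[F]_n) :=
  forall j, (U *m map_mx (in_alg L) M *m U^T) j j = 0.

Lemma zero_diagD M N : zero_diag M -> zero_diag N -> zero_diag (M + N).
Proof.
move=> ZM ZN j; rewrite map_mxD mulmxDr mulmxDl.
by rewrite mxE (ZM j) (ZN j) addr0.
Qed.

Lemma zero_diagN M : zero_diag M -> zero_diag (- M).
Proof. by move=> ZM j; rewrite map_mxN mulmxN mulNmx mxE (ZM j) oppr0. Qed.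

Lemma zero_diag_tr M : zero_diag M -> zero_diag M^T.
Proof.
move=> ZM j; rewrite -map_trmx (_ : _ *m _ = (U *m map_mx (in_alg L) M *m U^T)^T).
  by rewrite mxE.
by rewrite !trmx_mul trmxK mulmxA.
Qed.

(** Expanding the trace turns the entry into a sum over [l] of terms carrying two Kronecker deltas,
    for [l + m = j] and [l = j] modulo [n]; both hold only if [n] divides [m]. *)
Lemma zero_diag_frob (m : int) (b : L) : (m %% n%:Z)%Z != 0 ->
  zero_diag (form_mx e (fun x y => trace (b * frob m x * y))).
Proof.
move=> m0 j; rewrite mxE.
transitivity (\sum_(l < n) frob l%:Z b
    * (\sum_i U j i * frob (l%:Z + m) (tnth e i))
    * (\sum_i U j i * frob l%:Z (tnth e i))).
  under [RHS]eq_bigr do rewrite mulr_sumr.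
  rewrite exchange_big; apply: eq_bigr => i' _.
  rewrite !mxE mulr_suml.
  under [LHS]eq_bigr => i _.
    rewrite !mxE /= trace_sum_frob dimL mulr_sumr mulr_suml.
  over.
  rewrite exchange_big; apply: eq_bigr => l _.
  rewrite mulr_sumr mulr_suml; apply: eq_bigr => i _.
  by rewrite !frobM frobD; ring.
rewrite big1 // => l _; rewrite !inv_moore_frob.
case: eqP => [lm|]; case: eqP => [lj|]; rewrite ?mulr0 ?mul0r //.
case/negP: m0; move: lm; rewrite -lj => /eqP; rewrite eqz_mod_dvd addrAC subrr.
by rewrite add0r => /dvdz_mod0P ->.
Qed.

Lemma zero_diag_sym_frob (m : int) (b : L) : (m %% n%:Z)%Z != 0 ->
  zero_diag (form_mx e (fun x y => trace (b * (frob m x * y + frob m y * x)))).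
Proof.
move=> m0; have Zm := zero_diag_frob b m0.
rewrite (_ : form_mx _ _ = form_mx e (fun x y => trace (b * frob m x * y))
    + (form_mx e (fun x y => trace (b * frob m x * y)))^T).
  by apply: zero_diagD => //; apply: zero_diag_tr.
by apply/matrixP=> i j; rewrite !mxE -traceD mulrDr !mulrA.
Qed.

(** * Images of the forms [Tr(c x y)] under an equivalence *)

Lemma map_trace_form (sigma : {rmorphism F -> F}) (phi : {rmorphism L -> L})
    (c : L) : (forall a : F, phi a%:A = (sigma a)%:A) ->
  map_mx (in_alg L) (map_mx sigma (form_mx e (fun x y => trace (c * x * y))))
  = map_mx phi (moore_mx *m diag_mx (\row_l frob l%:Z c) *m moore_mx^T).
Proof.
move=> phiE; apply/matrixP => i j; rewrite !mxE /= -phiE trace_sum_frob dimL.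
congr (phi _); apply: eq_bigr => l _.
by rewrite mul_mx_diag !mxE !frobM; ring.
Qed.

(* Up to the factor [a], the diagonal entries in question are
   [\sum_i W j i ^+ 2 * phi (frob i c)] with [W := U *m P^T *m phi(V)]; letting [c] run over the basis, invertibility of
   the Moore matrix forces every [W j i ^+ 2] to vanish. *)
Lemma trace_forms_not_zero_diag (a : F) (P : 'M[F]_n)
    (sigma : {rmorphism F -> F}) : a != 0 -> P \in unitmx ->
  ~ (forall c, zero_diag (a *: (P^T *m map_mx sigma
       (form_mx e (fun x y => trace (c * x * y))) *m P))).
Proof.
move=> a0 Pu Z; have [phi phiE] := finField_rmorphism_extend L sigma.
pose W := U *m map_mx (in_alg L) P^T *m map_mx phi moore_mx.
have Wu : W \in unitmx.
  by rewrite !unitmx_mul unitmx_inv moore_mx_unit !map_unitmx unitmx_tr Pu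
    moore_mx_unit.
have n_gt0 : (0 < n)%N by rewrite -dimL adim_gt0.
have W0 : W = 0.
  apply/matrixP => j i; rewrite [RHS]mxE.
  pose w : 'rV[L]_n := \row_i (W j i ^+ 2).
  suffices /rowP/(_ i) : w = 0 by rewrite !mxE => /eqP; rewrite sqrf_eq0 => /eqP.
  have phiVu : (map_mx phi moore_mx)^T \in unitmx.
    by rewrite unitmx_tr map_unitmx moore_mx_unit.
  apply: (can_inj (mulmxK phiVu)); rewrite mul0mx; apply/rowP => l.
  rewrite mxE [RHS]mxE.
  have /eqP := Z (tnth e l) j.
  rewrite map_mxZ /= !map_mxM (map_trace_form _ phiE) !map_mxM.
  rewrite -scalemxAr -scalemxAl mxE mulf_eq0.
  rewrite scaler_eq0 oner_eq0 orbF (negPf a0) /= => /eqP Zj.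
  rewrite -[RHS]Zj map_diag_mx.
  (* The factors to the right of the diagonal matrix are the transposes of those to its left, so
     they assemble into [W^T]. *)
  rewrite (_ : _ *m _ = W *m diag_mx (map_mx phi (\row_l0 frob l0%:Z (tnth e l)))
    *m W^T); last first.
    by rewrite /W -!map_trmx !trmx_mul trmxK !mulmxA.
  rewrite mul_mx_diag mxE; apply: eq_bigr => i' _; rewrite !mxE; ring.
pose i0 : 'I_n := Ordinal n_gt0.
have /matrixP/(_ i0 i0) := mulmxV Wu; rewrite W0 mul0mx !mxE eqxx => /eqP.
by rewrite eq_sym oner_eq0.
Qed.

End Moore.

(** * Comparison of the two codes *)

Lemma coprime_mul_modz_neq0 (t m : int) (n : nat) :
  gcdz t n = 1 -> 0 < m < n%:Z -> ((t * m) %% n%:Z)%Z != 0.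
Proof.
move=> tn /andP[m_gt0 ltmn]; apply/eqP => /dvdz_mod0P.
rewrite Gauss_dvdzr; last by rewrite /coprimez gcdzC tn.
move=> /dvdz_mod0P; rewrite modz_small => [m0|]; first by rewrite m0 in m_gt0.
by rewrite (ltW m_gt0).
Qed.

Lemma zero_diag_T_code (F : finFieldType) (L : splittingFieldType F) (k : nat)
    (K : {subfield L}) (e : (2 * k).-tuple L) (eta : L) (t : int) M :
  (2 < k)%N -> \dim {:L} = (2 * k)%N -> basis_of {:L} e ->
  gcdz t (2 * k)%N%:Z = 1 -> T_code e k K t eta M -> zero_diag e M.
Proof.
move=> k_gt2 dimL basis_e t_coprime [b0 [b1 [b2 [_ _ ->]]]].
rewrite (_ : form_mx _ _ =
  form_mx e (fun x y => trace (b0 * frob k%:Z x * y)) +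
  form_mx e (fun x y => trace (b1 * (frob (t * (k%:Z - 1)) x * y
                                     + frob (t * (k%:Z - 1)) y * x))) +
  form_mx e (fun x y => trace (eta * b2 * (frob (t * (k%:Z - 2)) x * y
                                     + frob (t * (k%:Z - 2)) y * x)))); last first.
  by apply/matrixP => i j; rewrite !mxE -!traceD.
apply: zero_diagD; first apply: zero_diagD.
- apply: zero_diag_frob => //; rewrite modz_nat modn_small; lia.
- apply: zero_diag_sym_frob => //; apply: coprime_mul_modz_neq0 => //; lia.
(* Here [2 < k] ensures that [k - 2] is positive. *)
- apply: zero_diag_sym_frob => //; apply: coprime_mul_modz_neq0 => //; lia.
Qed.

Theorem theorem4p1 (F : finFieldType) (L : splittingFieldType F) (k : nat)
    (K : {subfield L}) (e : (2 * k).-tuple L) (eta : L) (s t : int)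
    (k_gt2 : (2 < k)%N)
    (q_odd : odd #|F|)
    (dimL : \dim {:L} = (2 * k)%N)
    (dimK : \dim K = k)
    (basis_e : basis_of {:L} e)
    (eta_nonsquare : ~ exists z : L, eta = z ^+ 2)
    (s_coprime : gcdz s (2 * k)%N%:Z = 1)
    (t_coprime : gcdz t (2 * k)%N%:Z = 1) :
  ~ sym_equiv (S_code e s) (T_code e k K t eta).
Proof.
move=> [a [P [sigma [S0 [a0 Pu _ _ codeE]]]]].
pose Q c := form_mx e (fun x y : L => trace (c * x * y)).
have Z c : zero_diag e (a *: (P^T *m map_mx sigma (Q c) *m P) + S0).
  apply: (@zero_diag_T_code _ _ _ K _ eta t) => //.
  apply/codeE; exists (Q c) => //; exists c, 0.
  by apply/matrixP => i j; rewrite !mxE /S_form mul0r addr0.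
(* The zero form is sent to [S0], so [S0] itself has zero diagonal and the translation can be
   undone. *)
have ZS0 : zero_diag e (- S0).
  have Q0 : Q 0 = 0 by apply/matrixP => i j; rewrite !mxE !mul0r trace0.
  by apply: zero_diagN; have := Z 0; rewrite Q0 map_mx0 mulmx0 mul0mx scaler0 add0r.
apply: (trace_forms_not_zero_diag dimL basis_e a0 Pu (sigma := sigma)) => c.
by rewrite -(addrK S0 (_ *: _)); exact: zero_diagD (Z c) ZS0.
Qed.
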